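(* Let $n\ge1$. If $H$ is dense in $\widehat{\mathcal F_n}$, then $X\in H$ is $\sqcup$-irreducible (as an element of the lattice $H$) if and only if for all (incomparable) $w_0,w_1\in X$ there exists an element $w\in X$ with $w\geqslant w_0$ and $w\geqslant w_1$, i.e. $X$ as a subset of $(K_n,\le)$ is upward filtering.
   Context: Fix $n\ge1$ and symbols $P_1,\dots,P_n$. The partially ordered set $(K_n,\le)$ with valuation map $\mathrm{val}:K_n\to\mathfrak P(\{P_1,\dots,P_n\})$ is the increasing union of finite sets $K_n^d$ ($d\ge 0$) built recursively: $K_n^{-1}=\emptyset$, and $K_n^d\setminus K_n^{d-1}$ consists of exactly one point $w_{\beta,Y}$ for each pair $(\beta,Y)$ such that (i) $Y$ is a decreasing subset of $K_n^{d-1}$ with $Y\not\subseteq K_n^{d-2}$ (for $d=0$ this last condition is void, so $Y=\emptyset$); (ii) $\beta\subseteq\{P_1,\dots,P_n\}$ and $\beta\subseteq\mathrm{val}(w')$ for all $w'\in Y$; (iii) if $Y$ is the decreasing set generated by a single element $w_{\beta',Y'}$, then $\beta\ne\beta'$. One sets $\mathrm{val}(w_{\beta,Y})=\beta$, and $w\le w_{\beta,Y}$ iff $w\in Y$ or $w=w_{\beta,Y}$. $\widehat{\mathcal F_n}:=\mathcal O_\downarrow(K_n,\le)$ is the Heyting algebra of all decreasing subsets of $K_n$ ($\sqcap=\cap$, $\sqcup=\cup$, $a\to b$ = the largest decreasing set contained in $(K_n\setminus a)\cup b$). It carries the metric $\mathrm d(a,b)=2^{-\min\{i\in\mathbb N\mid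 a\cap K_n^i\neq b\cap K_n^i\}}$ ($2^{-\min\emptyset}=0$). ''$H$ is dense in $\widehat{\mathcal F_n}$'' means that $H$ is a Heyting sub-algebra of $\widehat{\mathcal F_n}$ that is dense for this metric. An element $a$ of a lattice is $\sqcup$-irreducible if it is different from $0$ and cannot be written as $b_1\sqcup b_2$ with $b_1\neq a$ and $b_2\ne a$. *)

(* Defs.v *)
From HB Require Import structures.
From Stdlib Require Rdefinitions.
From mathcomp Require Import all_boot all_order all_algebra finmap.
From mathcomp Require Import boolp classical_sets topology Rstruct.

Set Implicit Arguments.
Unset Strict Implicit.
Unset Printing Implicit Defensive.

Import Order.TTheory GRing.Theory Num.Theory.

Local Notation R := Rdefinitions.R.

(* Raw points: a raw point is a set of symbols (P_1, ..., P_n being the elements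
   of 'I_n) together with a list of raw points.  This type is only a universe in
   which the finite sets K_n^d are carved out; the point w_(beta, Y) uses the
   canonical enumeration of the finite set Y, so that (beta, Y) |-> w_(beta, Y)
   is injective. *)
Inductive point (n : nat) : Type :=
  Point of {set 'I_n} & seq (point n).

Section PointChoice.
Variable n : nat.

Fixpoint point_size (w : point n) : nat :=
  let: Point _ s := w in (sumn (map point_size s)).+1.

Fixpoint encode (w : point n) : GenTree.tree {set 'I_n} :=
  let: Point b s := w in GenTree.Node 0 (GenTree.Leaf b :: map encode s).

Fixpoint decode (t : GenTree.tree {set 'I_n}) : option (point n) :=
  if t is GenTree.Node _ (GenTree.Leaf b :: l)
  then Some (Point b (pmap id (map decode l))) else None.

Lemma encodeK : pcancel encode decode.
Proof.
rewrite /pcancel; fix IH 1; case=> b s /=; congr (Some (Point b _)).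
by elim: s => //= w s ->; rewrite IH.
Qed.

HB.instance Definition _ := Choice.copy (point n) (pcan_type encodeK).

End PointChoice.

Section Construction.
Variable n : nat.
Local Open Scope fset_scope.
Implicit Types (w v : point n) (b : {set 'I_n}) (Y E : {fset point n})
  (C : pred {fset point n}).

Definition w_ b Y : point n := Point b (enum_fset Y).

Definition valuation w : {set 'I_n} := let: Point b _ := w in b.

Definition below w : {fset point n} := let: Point _ s := w in [fset v in s].

Definition point_le v w : bool := (v \in below w) || (v == w).

Lemma valuation_w b Y : valuation (w_ b Y) = b.
Proof. by []. Qed.

Lemma below_w b Y : below (w_ b Y) = Y.
Proof. by apply/fsetP => v; rewrite !inE. Qed.

Lemma w_inj b b' Y Y' : w_ b Y = w_ b' Y' -> b = b' /\ Y = Y'.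
Proof.
by move=> e; rewrite -(valuation_w b Y) -{2}(below_w b Y) e below_w.
Qed.

Definition decreasing_in E Y : bool :=
  (Y `<=` E) &&
  [forall w : Y, [forall v : E, point_le (val v) (val w) ==> (val v \in Y)]].

Definition admissible E b Y : bool :=
  [&& decreasing_in E Y,
      [forall w : Y, b \subset valuation (val w)] &
      [forall w : E, (Y == [fset v in E | point_le v (val w)]) ==>
                       (b != valuation (val w))]].

(* The points w_(b, Y), where Y ranges over the decreasing subsets of E that
   satisfy the extra condition C. *)
Definition layer E C : {fset point n} :=
  [fset w_ b Y | b : {set 'I_n}, Y in fpowerset E & admissible E b Y && C Y].

(* [Klevel d] is K_n^d.  Since K_n^(-1) is empty, the case d = 0 is the layer
   over fset0, without the condition that Y is not a subset of K_n^(d-2). *)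
Fixpoint Klevel (d : nat) : {fset point n} :=
  if d is d1.+1 then
    Klevel d1 `|` layer (Klevel d1)
      (fun Y => ~~ (Y `<=` (if d1 is d2.+1 then Klevel d2 else fset0)))
  else layer fset0 xpredT.

Lemma layerP E C w : reflect
  (exists b Y, [/\ w = w_ b Y, Y `<=` E, admissible E b Y & C Y])
  (w \in layer E C).
Proof.
apply: (iffP (imfset2P _ _ _ _ _)) => [[b _ [Y]]|[b [Y [-> YE ad CY]]]].
  by rewrite inE /= fpowersetE => /and3P[YE ad CY] ->; exists b, Y.
by exists b => //; exists Y; rewrite // inE /= fpowersetE YE ad.
Qed.

Lemma Klevel_mono d e : d <= e -> Klevel d `<=` Klevel e.
Proof.
elim: e => [|e IH]; first by rewrite leqn0 => /eqP->.
rewrite leq_eqVlt => /predU1P[-> //|]; rewrite ltnS => /IH h.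
by apply: fsubset_trans h _; rewrite /= fsubsetUl.
Qed.

Lemma Klevel_in d w : w \in Klevel d ->
  exists E, [/\ decreasing_in E (below w), E `<=` Klevel d &
    E = fset0 \/ exists e, E = Klevel e].
Proof.
elim: d => [|d IH] /=.
  case/layerP=> b [Y [-> YE /and3P[dY _ _] _]]; exists fset0.
  by rewrite below_w; split; [| exact: fsub0set | left].
rewrite inE => /orP[/IH[E [dE EK h]]|].
  by exists E; split=> //; apply: fsubset_trans EK _; rewrite fsubsetUl.
case/layerP=> b [Y [-> YE /and3P[dY _ _] _]]; exists (Klevel d).
by rewrite below_w; split; [| exact: fsubsetUl | right; exists d].
Qed.

Lemma below_Klevel d v w : w \in Klevel d -> v \in below w -> v \in Klevel d.
Proof.
case/Klevel_in=> E [/andP[/fsubsetP bE _] /fsubsetP EK _] vw.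
exact/EK/bE.
Qed.

Lemma below_trans d u v w : w \in Klevel d ->
  u \in below v -> v \in below w -> u \in below w.
Proof.
case/Klevel_in=> E [/andP[/fsubsetP bE /forallP dE] _ hE] uv vw.
have uE : u \in E.
  move: (bE _ vw); case: hE => [->|[e ->]]; first by rewrite inE.
  by move=> /below_Klevel; apply.
move: (dE [` vw]) => /forallP /(_ [` uE]) /implyP; apply.
by rewrite /point_le uv.
Qed.

Lemma below_size v w : v \in below w -> point_size v < point_size w.
Proof.
case: w => b s /=; rewrite !inE ltnS.
elim: s => //= w s IH; rewrite inE => /predU1P[->|/IH h].
  exact: leq_addr.
exact: leq_trans h (leq_addl _ _).
Qed.

End Construction.

(* The poset K_n, the union of the K_n^d. *)
Definition K (n : nat) : Type :=
  {w : point n | `[< exists d, w \in Klevel n d >]}.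

HB.instance Definition _ n := SubChoice.on (K n).

Fact K_display : Order.disp_t. Proof. exact: Order.Disp tt tt. Qed.

Section KOrder.
Variable n : nat.
Implicit Types v w : K n.

Definition Kle v w : bool := point_le (val v) (val w).

Lemma Kle_refl : reflexive Kle.
Proof. by move=> w; rewrite /Kle /point_le eqxx orbT. Qed.

Lemma Kle_anti : antisymmetric Kle.
Proof.
move=> v w /andP[/orP[vw|/eqP/val_inj //] /orP[wv|/eqP/val_inj //]].
by have := ltn_trans (below_size vw) (below_size wv); rewrite ltnn.
Qed.

Lemma Kle_trans : transitive Kle.
Proof.
move=> v u w /orP[uv|/eqP/val_inj -> //] /orP[vw|/eqP/val_inj <-]; last first.
  by rewrite /Kle /point_le uv.
have [d wd] := asboolP _ (valP w).
by rewrite /Kle /point_le (below_trans wd uv vw).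
Qed.

HB.instance Definition _ := Order.Le_isPOrder.Build K_display (K n)
  Kle_refl Kle_anti Kle_trans.

Definition Klev (d : nat) : set (K n) := [set w | val w \in Klevel n d]%classic.

End KOrder.
Arguments Klev : clear implicits.

Section Posets.
Local Open Scope classical_set_scope.
Local Open Scope order_scope.
Context {disp : Order.disp_t}.

Definition decreasing {T : porderType disp} (a : set T) : Prop :=
  forall v w, a w -> v <= w -> a v.

(* As usual for filtering sets, nonemptiness is part of the notion (the empty
   set is never join-irreducible). *)
Definition upward_filtering {T : porderType disp} (X : set T) : Prop :=
  X !=set0 /\
  forall w0 w1, X w0 -> X w1 -> exists2 w, X w & w0 <= w /\ w1 <= w.

(* Join-irreducibility in a sublattice H that contains \bot. *)
Definition join_irreducible_in {L : bLatticeType disp} (H : set L) (a : L) :=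
  [/\ H a, a <> \bot &
      ~ exists b1 b2, [/\ H b1, H b2, a = b1 `|` b2, b1 <> a & b2 <> a]].

End Posets.

(* The Heyting algebra of all decreasing subsets of K_n. *)
Definition Fhat (n : nat) : Type := {a : set (K n) | `[< decreasing a >]}.

HB.instance Definition _ n := SubChoice.on (Fhat n).

Fact Fhat_display : Order.disp_t. Proof. exact: Order.Disp tt tt. Qed.

Section FhatLattice.
Variable n : nat.
Local Open Scope classical_set_scope.
Implicit Types a b c : Fhat n.

Let S : pred (set (K n)) := fun x => `[< decreasing x >].

Fact decreasingI : meet_closed S.
Proof.
move=> a b /asboolP da /asboolP db; apply/asboolP => v w [aw bw] vw.
by split; [exact: da vw | exact: db vw].
Qed.

Fact decreasingU : join_closed S.
Proof.
move=> a b /asboolP da /asboolP db; apply/asboolP => v w [aw|bw] vw.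
  by left; exact: da vw.
by right; exact: db vw.
Qed.

Fact decreasing0 : (\bot : set (K n))%O \in S.
Proof. exact/asboolP. Qed.

Fact decreasing1 : (\top : set (K n))%O \in S.
Proof. exact/asboolP. Qed.

HB.instance Definition _ := Order.SubChoice_isTBSubLattice.Build
  _ _ _ Fhat_display (Fhat n) decreasingI decreasingU decreasing0 decreasing1.

Lemma val_meet a b : \val (a `&` b)%O = \val a `&` \val b.
Proof. by []. Qed.

Lemma val_join a b : \val (a `|` b)%O = \val a `|` \val b.
Proof. by []. Qed.

Lemma val_bot : \val (\bot : Fhat n)%O = set0.
Proof. by []. Qed.

Lemma val_top : \val (\top : Fhat n)%O = setT.
Proof. by []. Qed.

Definition imp_set a b : set (K n) :=
  \bigcup_(c in [set c | decreasing c /\ c `<=` ~` \val a `|` \val b]) c.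

Fact imp_subproof a b : `[< decreasing (imp_set a b) >].
Proof.
apply/asboolP => v w [c [dc ca] cw] vw.
by exists c => //; exact: dc vw.
Qed.

Definition imp a b : Fhat n := exist _ (imp_set a b) (imp_subproof a b).

Lemma impP a b c : (c <= imp a b)%O = (c `&` a <= b)%O.
Proof.
rewrite -!Order.le_val val_meet.
apply/subsetPset/subsetPset => [h w [cw aw]|h w cw].
  by have [e [_ /(_ w) he] /he[]] := h w cw.
have dc := asboolP _ (valP c).
exists (\val c) => //; split => // v cv.
by have [av|] := pselect ((\val a : set _) v); [right; apply: h | left].
Qed.

Record heyting_subalgebra (H : set (Fhat n)) : Prop := HeytingSubalgebra {
  heyting0 : H \bot%O ;
  heyting1 : H \top%O ;
  heytingI : forall a b, H a -> H b -> H (a `&` b)%O ;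
  heytingU : forall a b, H a -> H b -> H (a `|` b)%O ;
  heyting_imp : forall a b, H a -> H b -> H (imp a b) }.

End FhatLattice.

Section FhatMetric.
Variable n : nat.
Local Open Scope classical_set_scope.
Local Open Scope ring_scope.
Implicit Types a b c : Fhat n.

Definition differ a b : pred nat :=
  fun i => `[< \val a `&` Klev n i <> \val b `&` Klev n i >].

Definition Fdist a b : R :=
  if pselect (exists i, differ a b i) is left ex
  then 2^-1 ^+ ex_minn ex else 0.

Lemma Fdist_ge a b i : differ a b i -> 2^-1 ^+ i <= Fdist a b.
Proof.
rewrite /Fdist => di; case: pselect => [ex|[]]; last by exists i.
case: ex_minnP => m _ /(_ _ di) mi; apply: ler_wiXn2l => //.
  by rewrite invr_ge0.
by rewrite invf_le1 // ler1n.
Qed.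

Lemma Fdist_ge0 a b : 0 <= Fdist a b.
Proof.
by rewrite /Fdist; case: pselect => // ex; rewrite exprn_ge0 ?invr_ge0.
Qed.

Lemma Fdist_refl a : Fdist a a = 0.
Proof. by rewrite /Fdist; case: pselect => // -[i /asboolP[]]. Qed.

Lemma differ_sym a b i : differ a b i = differ b a i.
Proof. by apply/asboolP/asboolP => h e; apply: h. Qed.

Lemma Fdist_sym a b : Fdist a b = Fdist b a.
Proof.
have sub c d : Fdist c d <= Fdist d c.
  rewrite {1}/Fdist; case: pselect => [ex|_]; last exact: Fdist_ge0.
  by case: ex_minnP => m dm _; apply: Fdist_ge; rewrite differ_sym.
by apply/eqP; rewrite eq_le !sub.
Qed.

Lemma Fdist_eq0 a b : Fdist a b = 0 -> a = b.
Proof.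
have sub c d : Fdist c d = 0 -> \val c `<=` \val d.
  move=> cd0 w cw; have [i wi] := asboolP _ (valP w).
  have e : \val c `&` Klev n i = \val d `&` Klev n i.
    apply: contrapT => /asboolP /Fdist_ge; rewrite cd0 leNgt.
    by rewrite exprn_gt0 // invr_gt0.
  suff: (\val d `&` Klev n i) w by case.
  by rewrite -e.
move=> ab0; apply: val_inj; rewrite eqEsubset.
by split; apply: sub => //; rewrite Fdist_sym.
Qed.

Lemma Fdist_triangle b a c : Fdist a c <= Fdist a b + Fdist b c.
Proof.
rewrite {1}/Fdist; case: pselect => [ex|_]; last by rewrite addr_ge0 ?Fdist_ge0.
case: ex_minnP => m /asboolP ac _.
have [ab|ab] := boolP (differ a b m).
  by apply: le_trans (Fdist_ge ab) _; rewrite lerDl Fdist_ge0.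
have [bc|bc] := boolP (differ b c m).
  by apply: le_trans (Fdist_ge bc) _; rewrite lerDr Fdist_ge0.
case: ac; transitivity (\val b `&` Klev n m); apply: contrapT => /asboolP h.
  by rewrite /differ h in ab.
by rewrite /differ h in bc.
Qed.

HB.instance Definition _ := @isMetric.Build R (Fhat n)
  Fdist Fdist_refl Fdist_eq0 Fdist_sym Fdist_triangle.

Definition dense_in_Fhat (H : set (Fhat n)) : Prop :=
  heyting_subalgebra H /\ dense H.

End FhatMetric.

(* Main.v *)
(** A point of K_n of level e + 1 lies above a point of level exactly e.  Hence a
   decreasing set whose trace on K_n^(d+1) lies in K_n^d equals that trace, and
   every decreasing subset of some K_n^d is isolated in the metric, so belongs
   to every dense H.  Thus H contains the sets {v | v <= w} and {v | v < w},
   and therefore the implication from the first to the second, which is the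
   complement of {v | w <= v}.  If w0 and w1 have no upper bound in X, then X is
   the join of its proper parts outside the up-sets of w0 and of w1. *)
Require Import Defs.
From mathcomp Require Import all_boot all_order classical_sets.
From mathcomp Require Import all_algebra finmap boolp topology Rstruct.

Set Implicit Arguments.
Unset Strict Implicit.
Unset Printing Implicit Defensive.

Import Order.TTheory GRing.Theory Num.Theory.

Section Fhat.
Local Open Scope order_scope.
Local Open Scope classical_set_scope.
Variable n : nat.
Implicit Types (a b F X : Fhat n) (H : set (Fhat n)) (v w : K n).

Lemma Fhat_decreasing a : decreasing (\val a : set (K n)).
Proof. exact: asboolP _ (valP a). Qed.

(** A difference visible on [Klev n i] forces distance at least [2^-1 ^+ i], so any point of [H] in
    the ball of that radius around [a] will do. *)
Lemma dense_trace H a i : dense H ->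
  exists2 b, H b & \val a `&` Klev n i = \val b `&` Klev n i.
Proof.
move=> dH; have e0 : (0 < 2^-1 ^+ i :> Rdefinitions.R)%R.
  by rewrite exprn_gt0 // invr_gt0.
have [|b [/interior_subset ab Hb]] := dH _ _ (open_interior (ball a (2^-1 ^+ i)%R)).
  by exists a; apply: nbhsx_ballx.
exists b => //; apply: contrapT => /asboolP /Fdist_ge.
by move: ab; rewrite leNgt => ab /negP; apply.
Qed.

Lemma trace_stable a d : \val a `&` Klev n d.+1 `<=` Klev n d ->
  \val a `<=` Klev n d.
Proof.
move=> ad w aw; have [e we] := asboolP _ (valP w).
elim: e w aw we => [|e IH] w aw we.
  exact: fsubsetP (Klevel_mono n (leq0n d)) _ we.
have [ed|de] := leqP e d.
  by apply: ad; split=> //; apply: fsubsetP (Klevel_mono n _) _ we.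
move: (we); rewrite /= inE => /orP[/IH|]; first exact.
(* A new point of level [e.+1] has some element of [Y] outside the level [e - 1]. But [Y] lies in
   [a], so the induction hypothesis puts it inside [Klevel n d], and [d <= e - 1]. *)
case/layerP=> b [Y [wE YE _ /negP[]]]; apply/fsubsetP => v vY.
case: e de IH we YE => // e de IH _ /fsubsetP YE.
have vK : `[< exists d, v \in Klevel n d >] by apply/asboolP; exists e.+1; exact: YE.
apply: (fsubsetP (Klevel_mono n (de : d <= e)%N)).
apply: (IH (exist _ v vK)); last exact: YE.
apply: Fhat_decreasing aw _.
by rewrite /Order.le /= /Kle /point_le /= wE below_w vY.
Qed.

(** The approximation is taken at [d.+1] rather than [d]: agreement there also says that [a] has no
    point of level exactly [d.+1], hence none higher. *)
Lemma dense_bounded H F d : dense H -> \val F `<=` Klev n d -> H F.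
Proof.
move=> dH Fd; have [a Ha Fa] := dense_trace F d.+1 dH.
have Kd : Klev n d `<=` Klev n d.+1.
  by move=> w; apply/fsubsetP/Klevel_mono.
suff -> : F = a by [].
have /trace_stable ad : \val a `&` Klev n d.+1 `<=` Klev n d.
  by rewrite -Fa => w [/Fd].
apply: val_inj; rewrite -(setIidl (subset_trans Fd Kd)) Fa.
by rewrite (setIidl (subset_trans ad Kd)).
Qed.

Fact principal_subproof w : `[< decreasing [set v | v <= w] >].
Proof. by apply/asboolP => u v /= vw uv; apply: le_trans vw. Qed.

Definition principal w : Fhat n :=
  exist _ [set v | v <= w] (principal_subproof w).

Fact strict_principal_subproof w : `[< decreasing [set v | v < w] >].
Proof. by apply/asboolP => u v /= vw uv; apply: le_lt_trans vw. Qed.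

Definition strict_principal w : Fhat n :=
  exist _ [set v | v < w] (strict_principal_subproof w).

Fact not_above_subproof w : `[< decreasing [set v | ~ w <= v] >].
Proof. by apply/asboolP => u v /= vw uv wu; apply/vw/(le_trans wu). Qed.

Definition not_above w : Fhat n :=
  exist _ [set v | ~ w <= v] (not_above_subproof w).

(** The only point of [principal w] missing from [strict_principal w] is [w], so the implication is
    the largest decreasing set omitting [w]. *)
Lemma imp_principal w : imp (principal w) (strict_principal w) = not_above w.
Proof.
apply: val_inj; rewrite eqEsubset; split=> v /=.
  move=> [c [dc cw] cv] wv; have /cw[] := dc _ _ cv wv; first by case=> /=.
  by rewrite /= ltxx.
move=> wv; exists [set u | ~ w <= u] => //; split.
  exact: asboolP _ (not_above_subproof w).
move=> u /= wu; have [uw|] := boolP (u <= w); last by left; apply/negP.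
by right; rewrite /= lt_neqAle uw andbT; apply/eqP => uE; rewrite uE lexx in wu.
Qed.

Lemma dense_not_above H w : dense_in_Fhat H -> H (not_above w).
Proof.
move=> [hH dH]; rewrite -imp_principal; have [d wd] := asboolP _ (valP w).
have le_d v : v <= w -> Klev n d v.
  by case/orP=> [/(below_Klevel wd)|/eqP/val_inj ->].
apply: (heyting_imp hH); apply: (dense_bounded (d := d)) => //.
by move=> v /= /ltW /le_d.
Qed.

Lemma upward_filtering_irreducible H X : H X ->
  upward_filtering (\val X : set (K n)) -> join_irreducible_in H X.
Proof.
move=> HX [[w Xw] fX]; split=> // [X0|[b1 [b2 [_ _ XE]]]].
  by move: Xw; rewrite X0.
(* Each proper part of [X] misses a point; an upper bound in [X] of the two missed points lies in
   [b1] or [b2], which then contains the point it missed. *)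
have witness b : b <= X -> b <> X -> exists2 v, \val X v & ~ \val b v.
  rewrite -Order.le_val => /subsetPset bX bnX; apply: contrapT => nw.
  apply: bnX; apply: val_inj; rewrite eqEsubset; split=> // v Xv.
  by apply: contrapT => nbv; apply: nw; exists v.
move=> /witness[|v1 Xv1 nv1]; first by rewrite XE leUl.
move=> /witness[|v2 Xv2 nv2]; first by rewrite XE leUr.
have [v Xv [v1v v2v]] := fX _ _ Xv1 Xv2.
have : (\val b1 `|` \val b2) v by rewrite -val_join -XE.
case=> bv; [exact: nv1 (Fhat_decreasing bv v1v)|].
exact: nv2 (Fhat_decreasing bv v2v).
Qed.

Lemma irreducible_upward_filtering H X : dense_in_Fhat H ->
  join_irreducible_in H X -> upward_filtering (\val X : set (K n)).
Proof.
move=> dH [HX X0 irr]; split.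
  by apply/set0P/eqP => XE; apply: X0; apply: val_inj; rewrite XE.
move=> w0 w1 Xw0 Xw1; apply: contrapT => nub; apply: irr.
have proper w : \val X w -> (X `&` not_above w)%O <> X.
  move=> Xw /(congr1 val); rewrite val_meet => XE.
  by move: Xw; rewrite -XE => -[_ /=]; rewrite lexx; apply.
exists (X `&` not_above w0)%O, (X `&` not_above w1)%O.
split; [| |  | exact: proper | exact: proper].
- by apply: heytingI dH.1 _ _ HX _; exact: dense_not_above.
- by apply: heytingI dH.1 _ _ HX _; exact: dense_not_above.
apply: val_inj; rewrite val_join !val_meet -setIUr; apply/esym/setIidl.
(* A point of [X] lost from both parts would be a common upper bound of [w0] and [w1]. *)
move=> w Xw /=; apply: contrapT => /not_orP[/contrapT w0w /contrapT w1w].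
by apply: nub; exists w.
Qed.

End Fhat.

Theorem proposition7p1 (n : nat) (n_ge1 : (1 <= n)%N)
    (H : set (Fhat n)) (H_dense : dense_in_Fhat H)
    (X : Fhat n) (XH : H X) :
  join_irreducible_in H X <-> upward_filtering (\val X : set (K n)).
Proof.
split; first exact: irreducible_upward_filtering.
exact: upward_filtering_irreducible.
Qed.
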